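(* Let $\mu = -\alpha_{1,j}$ with $1 \leq j < r$ be a negative root of $\mathfrak{sl}_{r+1}(\mathbb{C})$ and let $\tilde\alpha$ be the highest root. The set $\mathrm{BAS}(\tilde\alpha, \mu)$ of basic allowable subwords of $\mathcal{A}(\tilde\alpha, \mu)$ consists of (a) $s_k$ with $1 \leq k < r$, (b) $s_{k+1}s_k$ with $2 \leq k \leq j-1$, (c) $s_ks_{k+1}$ with $2 \leq k \leq \min(j,r-2)$, (d) $s_ks_{k+1}s_k$ with $2 \leq k \leq j-1$, and (e) $s_{k+2}s_ks_{k+1}$ with $2 \leq k \leq j-2$.
   Context: Type $A_r$: the simple roots are $\alpha_i=e_i-e_{i+1}\in\mathbb{R}^{r+1}$ for $1\le i\le r$; the positive roots are $\alpha_{i,j}=\alpha_i+\alpha_{i+1}+\cdots+\alpha_j$ for $1\le i\le j\le r$; the highest root is $\tilde\alpha=\alpha_1+\cdots+\alpha_r$; $\rho$ is half the sum of the positive roots. The Weyl group $W\cong\mathfrak{S}_{r+1}$ is generated by the simple reflections $s_1,\dots,s_r$, where $s_k$ swaps $e_k$ and $e_{k+1}$. $\wp(\xi)$ is the number of ways of expressing $\xi$ as a linear combination of positive roots with nonnegative integer coefficients, and $\mathcal{A}(\lambda,\mu)=\{\sigma\in W:\wp(\sigma(\lambda+\rho)-\mu-\rho)>0\}$. The influence of $\sigma\in W$ is $I(\sigma)=\{i: s_i\text{ is in a reduced word for }\sigma\}$ and the extended influence is $\overline I(\sigma)=\{i: i\in I(\sigma) \text{ or } i+1\in I(\sigma)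 \text{ or } i-1\in I(\sigma)\}$. $I(\sigma)$ is connected if it induces a connected subgraph of the Dynkin diagram (the path $1-2-\cdots-r$), i.e. it is a set of consecutive integers. $\sigma,\tau$ are independent if $I(\sigma)\cap\overline I(\tau)=\emptyset$; a set is pairwise independent if any two distinct elements of it are independent. For $\lambda$ dominant integral and $\mathcal{A}(\lambda,\mu)\neq\emptyset$, $\mathrm{BAS}(\lambda,\mu)$ (the basic allowable subwords) is the unique subset $S\subseteq\mathcal{A}(\lambda,\mu)$ with $1\notin S$ such that each $b\in S$ has connected influence and every $\sigma\in\mathcal{A}(\lambda,\mu)$ is a product of the elements of a (possibly empty) pairwise independent subset of $S$. *)

(* Defs.v *)
From mathcomp Require Import all_boot all_order all_algebra all_fingroup.
From mathcomp Require Import finmap boolp classical_sets functions cardinality.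

Set Implicit Arguments.
Unset Strict Implicit.
Unset Printing Implicit Defensive.

Import GRing.Theory Num.Theory.
Local Open Scope ring_scope.

(* Simple roots, simple reflections and basis vectors are indexed by nat,
   starting from 1.  Out-of-range indices give junk values and are never used. *)
Definition coord (r k : nat) : 'I_r.+1 := inord k.-1.

Definition basis_vec (R : realFieldType) (r k : nat) : 'cV[R]_r.+1 :=
  delta_mx (coord r k) 0.

Definition simple_root (R : realFieldType) (r k : nat) : 'cV[R]_r.+1 :=
  basis_vec R r k - basis_vec R r k.+1.

Definition root_sum (R : realFieldType) (r i j : nat) : 'cV[R]_r.+1 :=
  \sum_(i <= k < j.+1) simple_root R r k.

(* The pairs 1 <= i <= j <= r, which index the positive roots. *)
Definition pos_index (r : nat) : finType :=
  {p : 'I_r.+1 * 'I_r.+1 | (1 <= p.1 <= p.2)%N}.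

Definition pos_root (R : realFieldType) (r : nat) (p : pos_index r) :
  'cV[R]_r.+1 := root_sum R r (val p).1 (val p).2.

Definition rho (R : realFieldType) (r : nat) : 'cV[R]_r.+1 :=
  2%:R^-1 *: \sum_(p : pos_index r) pos_root R p.

Definition highest_root (R : realFieldType) (r : nat) : 'cV[R]_r.+1 :=
  root_sum R r 1 r.

(* Products in 'S_n are read left to right, (s * t) i = t (s i), so
   perm_mx (s * t) = perm_mx s *m perm_mx t: this is a left action for that
   product, and s * t acts by applying t first.  The simple reflections, being
   involutions, act by swapping basis vectors. *)
Definition weyl_act (R : realFieldType) (r : nat) (s : 'S_r.+1)
  (v : 'cV[R]_r.+1) : 'cV[R]_r.+1 := perm_mx s *m v.

Definition simple_refl (r k : nat) : 'S_r.+1 :=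
  tperm (coord r k) (coord r k.+1).

Definition partitions (R : realFieldType) (r : nat) (xi : 'cV[R]_r.+1) :
  set {ffun pos_index r -> nat} :=
  [set m : {ffun pos_index r -> nat} |
    \sum_(p : pos_index r) pos_root R p *+ m p = xi]%classic.

(* [fset_set] is the empty set on infinite sets; [partitions xi] is always
   finite, see [finite_partitions] below. *)
Definition kostant (R : realFieldType) (r : nat) (xi : 'cV[R]_r.+1) : nat :=
  #|` fset_set (partitions xi)|.

Definition alternation_set (R : realFieldType) (r : nat)
  (lambda mu : 'cV[R]_r.+1) : {set 'S_r.+1} :=
  [set s : 'S_r.+1 |
    (0 < kostant (weyl_act s (lambda + rho R r) - mu - rho R r))%N].

Definition word_prod (r : nat) (w : seq nat) : 'S_r.+1 :=
  (\prod_(k <- w) simple_refl r k)%g.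

Definition is_word (r : nat) (w : seq nat) (s : 'S_r.+1) : Prop :=
  all (fun k => 1 <= k <= r)%N w /\ word_prod r w = s.

Definition reduced_word (r : nat) (w : seq nat) (s : 'S_r.+1) : Prop :=
  is_word w s /\ forall w', is_word w' s -> (size w <= size w')%N.

Definition influence (r : nat) (s : 'S_r.+1) : set nat :=
  [set i : nat | exists2 w : seq nat, reduced_word w s & i \in w]%classic.

Definition ext_influence (r : nat) (s : 'S_r.+1) : set nat :=
  [set i : nat | (1 <= i <= r)%N /\
     [\/ influence s i, influence s i.+1 | influence s i.-1]]%classic.

Definition dynkin_adj : rel nat := fun i k => (i.+1 == k) || (k.+1 == i).

Definition connected_in_dynkin (I : set nat) : Prop :=
  forall i k, I i -> I k ->
    exists p : seq nat,
      [/\ path dynkin_adj i p, last i p = k & forall x, x \in p -> I x].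

Definition independent (r : nat) (s t : 'S_r.+1) : Prop :=
  (influence s `&` ext_influence t = set0)%classic.

Definition pairwise_independent (r : nat) (T : {set 'S_r.+1}) : Prop :=
  forall s t, s \in T -> t \in T -> s != t -> independent s t.

(* Independent elements commute, so the order of the factors in the last
   condition is immaterial. *)
Definition generates_alternation_set (R : realFieldType) (r : nat)
  (lambda mu : 'cV[R]_r.+1) (S : {set 'S_r.+1}) : Prop :=
  [/\ S \subset alternation_set lambda mu,
      1%g \notin S,
      forall b, b \in S -> connected_in_dynkin (influence b)
    & forall s, s \in alternation_set lambda mu ->
        exists T : {set 'S_r.+1},
          [/\ T \subset S, pairwise_independent T
            & s = (\prod_(b in T) b)%g]].

Definition is_BAS (R : realFieldType) (r : nat) (lambda mu : 'cV[R]_r.+1)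
  (S : {set 'S_r.+1}) : Prop :=
  unique (generates_alternation_set lambda mu) S.

Section FinitePartitions.
Variables (R : realFieldType) (r : nat).

Lemma root_sumE (i j : nat) : (1 <= i <= j)%N ->
  root_sum R r i j = basis_vec R r i - basis_vec R r j.+1.
Proof.
case/andP=> i_gt0 le_ij.
rewrite /root_sum -opprB -telescope_sumr ?leqW // -sumrN.
by apply: eq_bigr => k _; rewrite opprB.
Qed.

(* On the root lattice, this is the height. *)
Let ht (v : 'cV[R]_r.+1) : R := - \sum_(k < r.+1) v k 0 *+ k.

Let ht_basis (k : nat) : (k <= r)%N -> ht (basis_vec R r k.+1) = - k%:R.
Proof.
move=> le_kr; rewrite /ht (bigD1 (inord k)) //= big1 => [|i ne_ik].
  by rewrite /basis_vec /coord mxE !eqxx /= inordK // addr0.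
by rewrite /basis_vec /coord mxE (negPf ne_ik) mul0rn.
Qed.

Let htB u v : ht (u - v) = ht u - ht v.
Proof.
rewrite /ht -opprD; congr (- _).
by rewrite -sumrB; apply: eq_bigr => k _; rewrite !mxE mulrnBl.
Qed.

Let ht0 : ht 0 = 0. Proof. by rewrite -(subrr 0) htB subrr. Qed.

Let htD u v : ht (u + v) = ht u + ht v.
Proof. by rewrite -[v in LHS]opprK -[- v]sub0r !htB ht0 sub0r opprK. Qed.

Let htMn u n : ht (u *+ n) = ht u *+ n.
Proof. by elim: n => [|n IHn]; rewrite ?mulr0n ?ht0 // !mulrS htD IHn. Qed.

Let ht_pos_root (p : pos_index r) :
  ht (pos_root R p) = ((val p).2 - (val p).1).+1%:R.
Proof.
case: p => -[[[|i] lt_i] [j lt_j]] //= le_ij.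
rewrite /pos_root root_sumE // htB !ht_basis //=; last by rewrite ltnW.
rewrite opprK addrC -natrB; last exact: ltnW.
by congr (_%:R); rewrite -subSn.
Qed.

Lemma finite_partitions (xi : 'cV[R]_r.+1) : finite_set (partitions xi).
Proof.
have ht_sum (m : {ffun pos_index r -> nat}) : partitions xi m ->
    ht xi = (\sum_(p : pos_index r) ((val p).2 - (val p).1).+1 * m p)%N%:R.
  move=> <-; rewrite (big_morph ht htD ht0) natr_sum.
  by apply: eq_bigr => p _; rewrite htMn ht_pos_root natrM mulr_natr.
have [[m0 m0P]|no] := pselect (exists m, partitions xi m); last first.
  suff -> : partitions xi = set0 by exact: finite_set0.
  by apply/seteqP; split=> // m mP; case: no; exists m.
set N := (\sum_(p : pos_index r) ((val p).2 - (val p).1).+1 * m0 p)%N.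
apply: (@sub_finite_set _ _
  [set [ffun p => val (f p)] | f in
    [set: {ffun pos_index r -> 'I_N.+1}]]%classic); last first.
  by apply: finite_image; exact: finite_finset.
move=> m mP; exists [ffun p => inord (m p)] => //.
apply/ffunP => p; rewrite !ffunE /= inordK // ltnS.
have /eqP := etrans (esym (ht_sum _ mP)) (ht_sum _ m0P).
rewrite eqr_nat => /eqP; rewrite -/N => <-.
by rewrite (bigD1 p) //= mulSn -addnA leq_addr.
Qed.

End FinitePartitions.

(* Main.v *)
Require Import Defs.
From HB Require Import structures.
From mathcomp Require Import all_boot all_order all_algebra all_fingroup.
From mathcomp Require Import finmap boolp classical_sets functions cardinality.
From mathcomp Require Import zify.

(** Everything is expressed by one statistic.  A permutation s of {0, ..., r}
    has, for each m, the excess D_m(s) = (s 0 + ... + s (m-1)) - (0 + ... + (m-1)),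
    the coefficient of alpha_m in rho - s rho.  It is nonnegative, it determines
    s, and it vanishes exactly when s stabilizes the initial segment [0, m)
    ([excess_eq0]).

    Influence.  Prefixing a letter k to a word changes only D_k, and in a reduced
    word it increases D_k.  Hence the influence of s is the set of indices m with
    D_m(s) <> 0 ([influenceP]).

    Uniqueness.  The influence of a product of independent elements is the
    union of their influences, with no two of these adjacent; so if it is
    connected, then there is only one factor.  Two sets that both generate the
    alternation set therefore contain each other ([generates_is_BAS]).

    Membership.  The vector s (lambda + rho) - mu - rho is a sum of positive roots
    if and only if its coefficients on the simple roots are nonnegative.  These
    coefficients are the D_m up to sign and corrections coming from lambda and
    mu, and they are nonnegative exactly when D_r = 0, D_1 = 0 or D_2 = 0, and
    D_m <= 2 for m <= j, D_m <= 1 for j < m ([admissibleP]).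

    Generation.  Since the entries of D are 0, 1 or 2 and s is injective, few
    sequences can occur between two consecutive zeros of D: only 1, 12, 21, 22
    and 212, starting at some index k ([leading_profile]).  They are the sequences
    of s_k, s_(k+1) s_k, s_k s_(k+1), s_k s_(k+1) s_k and s_(k+2) s_k s_(k+1),
    and the bounds on D become the ranges of k.  Cutting s at the zeros of D
    writes it as a product of such words, which are independent because zeros
    separate them ([admissible_factorization]). *)

Set Implicit Arguments.
Unset Strict Implicit.
Unset Printing Implicit Defensive.

Import GroupScope Order.TTheory GRing.Theory Num.Theory.
Local Open Scope ring_scope.

Local Notation coord := Defs.coord.

(** * The excess of a permutation *)

Definition image_at (r : nat) (s : 'S_r.+1) (i : nat) : nat := s (inord i).

(** The coefficient of alpha_m in rho - s rho: up to a constant vector, rho has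
    entry - i at position i. *)
Definition excess (r : nat) (s : 'S_r.+1) (m : nat) : int :=
  \sum_(0 <= i < m) ((image_at s i)%:Z - i%:Z).

Definition initial_stab (r m : nat) : {group 'S_r.+1} :=
  'N([set i : 'I_r.+1 | (i < m)%N] | 'P)%G.

Section Excess.
Variable r : nat.
Implicit Types (s t : 'S_r.+1) (i k m : nat).

Lemma excess0 s : excess s 0 = 0.
Proof. by rewrite /excess big_geq. Qed.

Lemma excessS s m : excess s m.+1 = excess s m + ((image_at s m)%:Z - m%:Z).
Proof. by rewrite /excess big_nat_recr. Qed.

Lemma image_at_ord s (i : 'I_r.+1) : image_at s i = s i :> nat.
Proof. by rewrite /image_at inord_val. Qed.

Lemma image_at_le s i : (image_at s i <= r)%N.
Proof. by rewrite -ltnS ltn_ord. Qed.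

Lemma image_at_inj s i k : (i <= r)%N -> (k <= r)%N ->
  image_at s i = image_at s k -> i = k.
Proof.
move=> le_ir le_kr /val_inj/perm_inj/(congr1 val).
by rewrite /= !inordK.
Qed.

Lemma image_atM s t i : image_at (s * t)%g i = image_at t (image_at s i).
Proof. by rewrite /image_at permM inord_val. Qed.

Lemma image_at_excess s m :
  (image_at s m)%:Z = m%:Z + (excess s m.+1 - excess s m).
Proof. by rewrite excessS; lia. Qed.

Lemma eq_from_image_at s t :
  (forall i, (i <= r)%N -> image_at s i = image_at t i) -> s = t.
Proof.
move=> eq_st; apply/permP=> i; apply: val_inj.
by rewrite /= -!image_at_ord eq_st // -ltnS.
Qed.

Lemma excess_inj s t :
  (forall m, (m <= r.+1)%N -> excess s m = excess t m) -> s = t.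
Proof.
move=> eq_st; apply: eq_from_image_at => i le_ir.
apply/eqP; rewrite -eqz_nat !image_at_excess !eq_st //; lia.
Qed.

Lemma excess_unique s (f : nat -> int) : f 0%N = 0 ->
    (forall i, (i <= r)%N -> f i.+1 = f i + ((image_at s i)%:Z - i%:Z)) ->
  forall m, (m <= r.+1)%N -> excess s m = f m.
Proof.
move=> f0 fS; elim=> [|m IHm] lt_m; first by rewrite excess0.
by rewrite excessS IHm 1?ltnW // fS.
Qed.

Lemma excess1 m : (m <= r.+1)%N -> excess (1%g : 'S_r.+1) m = 0.
Proof.
apply: (@excess_unique _ (fun=> 0)) => // i le_ir.
by rewrite /image_at perm1 inordK // subrr addr0.
Qed.

(** As {s 0, ..., s (m-1)} and {0, ..., m-1} have the same size, subtracting the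
    constant m from every summand of the excess changes nothing.  In this form
    each x contributes a nonnegative amount, which vanishes exactly when x lies
    in both sets, in neither, or is m itself. *)
Lemma excess_sum_ord s m : (m <= r.+1)%N ->
  excess s m = \sum_(x : 'I_r.+1)
    (((s^-1)%g x < m)%N%:Z - (x < m)%N%:Z) * (x%:Z - m%:Z).
Proof.
move=> le_m; rewrite /excess big_mkord.
rewrite (big_ord_widen r.+1 (fun i => (image_at s i)%:Z - i%:Z)) //.
transitivity (\sum_(i < r.+1 | (i < m)%N) ((s i)%:Z - m%:Z)
   - \sum_(i < r.+1 | (i < m)%N) (i%:Z - m%:Z)).
  rewrite -sumrB; apply: eq_bigr => i _; rewrite image_at_ord; lia.
rewrite (reindex_inj (@perm_inj _ s^-1%g)) /= [X in X - _]big_mkcond.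
rewrite [X in _ - X]big_mkcond -sumrB; apply: eq_bigr => x _.
by rewrite permKV; do 2![case: ifP => _]; lia.
Qed.

Lemma excess_term_ge0 (a : bool) (x m : nat) :
  0 <= (a%:Z - (x < m)%N%:Z) * (x%:Z - m%:Z).
Proof. by case: a; case: (ltnP x m) => ?; nia. Qed.

Lemma excess_ge0 s m : (m <= r.+1)%N -> 0 <= excess s m.
Proof.
by move/excess_sum_ord->; apply: sumr_ge0 => x _; apply: excess_term_ge0.
Qed.

Lemma mem_initial_stab s m :
  reflect (forall i : 'I_r.+1, (s i < m)%N = (i < m)%N) (s \in initial_stab r m).
Proof.
apply: (iffP idP) => [/astabsP sP i | sP].
  by have := sP i; rewrite !inE /= apermE.
by apply/astabsP=> i; rewrite !inE /= apermE.
Qed.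

(** Vanishing of the sum in [excess_sum_ord] puts [0, m) inside its image under
    s, and the two sets have the same size. *)
Lemma excess_eq0 s m : (m <= r.+1)%N ->
  (excess s m == 0) = (s \in initial_stab r m).
Proof.
move=> le_m; apply/idP/idP=> [|/mem_initial_stab sP]; last first.
  rewrite excess_sum_ord // big1 // => x _.
  by rewrite -sP permKV subrr mul0r.
rewrite excess_sum_ord // psumr_eq0 => [|x _]; last exact: excess_term_ge0.
move/allP=> e0; rewrite -groupV.
set A := [set i : 'I_r.+1 | (i < m)%N].
have subA: A \subset [set s i | i in A].
  apply/fintype.subsetP=> x xA; apply/imsetP.
  exists (s^-1%g x); last by rewrite permKV.
  move: xA (e0 x (mem_index_enum x)); rewrite !inE => lt_xm.
  rewrite lt_xm mulf_eq0 !subr_eq0 !eqz_nat (ltn_eqF lt_xm) orbF.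
  by case: (_ < m)%N.
have /eqP/setP eqA: A == [set s i | i in A].
  by rewrite eqEcard subA (card_imset _ (@perm_inj _ s)) /=.
apply/mem_initial_stab=> i; have := eqA i; rewrite inE => ->.
by rewrite -{2}(permKV s i) (mem_imset _ _ (@perm_inj _ s)) inE.
Qed.

Lemma excess_full s : excess s r.+1 = 0.
Proof.
by apply/eqP; rewrite excess_eq0 //; apply/mem_initial_stab=> i; rewrite !ltn_ord.
Qed.

Lemma image_at_refl k i : (1 <= k <= r)%N -> (i <= r)%N ->
  image_at (simple_refl r k) i = (i + (i.+1 == k) - (i == k))%N.
Proof.
move=> /andP[k1 kr] le_ir; rewrite /image_at /simple_refl /coord /=.
case: tpermP => [/(congr1 val)|/(congr1 val)|]; rewrite /= ?inordK; try lia.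
move=> /eqP + /eqP; rewrite -!val_eqE /= !inordK; lia.
Qed.

Lemma simple_reflK k : (simple_refl r k * simple_refl r k = 1)%g.
Proof. exact: tperm2. Qed.

(** Left multiplication by s_k exchanges the entries of s at the positions k - 1
    and k, and only the sum of the first k entries sees the exchange. *)
Lemma excess_refl_mul k s m : (1 <= k <= r)%N -> (m <= r.+1)%N ->
  excess (simple_refl r k * s)%g m =
  excess s m + (m == k)%:Z * ((image_at s k)%:Z - (image_at s k.-1)%:Z).
Proof.
move=> k_in; apply: (@excess_unique _ (fun m => excess s m + _)).
  have ->: (0 == k)%N = false by lia.
  by rewrite excess0 mul0r addr0.
move=> i le_ir; rewrite excessS image_atM image_at_refl //.
have [eSi|ne1] := eqVneq i.+1 k; last have [e2|ne2] := eqVneq i k.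
- have ->: (i == k) = false by lia.
  have ->: k.-1 = i by lia.
  have ->: (i + true - false)%N = k by lia.
  lia.
- have ->: (i + false - true)%N = k.-1 by lia.
  rewrite e2; lia.
- have ->: (i + false - false)%N = i by lia.
  lia.
Qed.

Lemma initial_stabV s m (i : 'I_r.+1) : (m <= r.+1)%N -> excess s m = 0 ->
  ((s^-1)%g i < m)%N = (i < m)%N.
Proof.
move=> le_m /eqP; rewrite excess_eq0 // -groupV => /mem_initial_stab; exact.
Qed.

Lemma image_atV s (i : 'I_r.+1) : image_at s ((s^-1)%g i) = i.
Proof. by rewrite image_at_ord permKV. Qed.

Lemma fixed_of_excess0 s (i : 'I_r.+1) :
  excess s i = 0 -> excess s i.+1 = 0 -> s i = i.
Proof.
move=> e0 e1; apply/val_inj/eqP; rewrite /= -image_at_ord -eqz_nat.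
by rewrite image_at_excess e0 e1 subrr addr0.
Qed.

End Excess.

(** * Inversions, reduced words and influence *)

Section Length.
Variable r : nat.
Implicit Types (s t : 'S_r.+1) (i k m : nat) (w : seq nat).

Definition inversions s : {set 'I_r.+1 * 'I_r.+1} :=
  [set p : 'I_r.+1 * 'I_r.+1 | (p.1 < p.2)%N && (s p.2 < s p.1)%N].

Definition is_letter k := (1 <= k <= r)%N.

(** The simple reflection s_k reverses the order of no pair of positions but
    (k - 1, k), so it carries inversions to inversions. *)
Lemma simple_refl_lt k (a b : 'I_r.+1) : is_letter k -> (a < b)%N ->
    (a, b) != (coord r k, coord r k.+1) ->
  (simple_refl r k a < simple_refl r k b)%N.
Proof.
move=> k_in lt_ab; rewrite xpair_eqE -!val_eqE /= !inordK; try by case/andP: k_in; lia.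
move=> ne; rewrite -!image_at_ord !image_at_refl //; try by rewrite -ltnS ltn_ord.
by move: k_in; rewrite /is_letter; lia.
Qed.

Lemma card_inversions_asc k s : is_letter k ->
    (image_at s k.-1 < image_at s k)%N ->
  #|inversions (simple_refl r k * s)%g| = (#|inversions s|).+1.
Proof.
move=> k_in asc.
pose tau : 'S_r.+1 := simple_refl r k.
pose tau2 (p : 'I_r.+1 * 'I_r.+1) := (tau p.1, tau p.2).
have tauK: involutive tau by move=> x; rewrite -permM simple_reflK perm1.
have tau2K: involutive tau2 by case=> a b; rewrite /tau2 /= !tauK.
have tau_l : tau (coord r k) = coord r k.+1 by rewrite /tau tpermL.
have tau_r : tau (coord r k.+1) = coord r k by rewrite /tau tpermR.
have asc' : (s (coord r k) < s (coord r k.+1))%N by [].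
have lt_c : (coord r k < coord r k.+1)%N.
  by rewrite /coord !inordK; case/andP: k_in; lia.
have -> : inversions (tau * s)%g =
    (coord r k, coord r k.+1) |: tau2 @: inversions s.
  apply/setP=> p; rewrite !inE -[X in X \in _ @: _]tau2K (mem_imset _ _ (inv_inj tau2K)).
  rewrite inE !permM; case: eqVneq => [->|]; first by rewrite lt_c /= tau_l tau_r.
  case: p => a b /= ne; apply: andb_id2r => lt_s.
  apply/idP/idP=> [lt_ab|lt_ta]; first exact: simple_refl_lt.
  rewrite -[a]tauK -[b]tauK; apply: simple_refl_lt => //.
  apply: contraTneq lt_s => -[-> ->]; rewrite -leqNgt ltnW //.
rewrite cardsU1 card_imset; last exact: inv_inj.
rewrite -[X in X \in _ @: _]tau2K (mem_imset _ _ (inv_inj tau2K)) inE /= tau_l tau_r.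
by rewrite ltnNge (ltnW lt_c).
Qed.

Lemma image_at_ne k s : is_letter k -> image_at s k.-1 <> image_at s k.
Proof.
by case/andP=> k1 kr /image_at_inj; lia.
Qed.

Lemma card_inversions_desc k s : is_letter k ->
    (image_at s k < image_at s k.-1)%N ->
  #|inversions s| = (#|inversions (simple_refl r k * s)%g|).+1.
Proof.
move=> k_in desc; rewrite -(card_inversions_asc k_in) ?mulgA ?simple_reflK ?mul1g //.
rewrite !image_atM !image_at_refl //; try by case/andP: k_in; lia.
case/andP: k_in => k1 kr.
have -> : (k.-1 + (k.-1.+1 == k) - (k.-1 == k))%N = k by lia.
by have -> : (k + (k.+1 == k) - (k == k))%N = k.-1 by lia.
Qed.

(** Without descents s is increasing, hence s i >= i, so the excess grows with m;
    but it starts and ends at 0. *)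
Lemma no_descent_eq1 s :
  (forall k, is_letter k -> (image_at s k.-1 < image_at s k)%N) -> s = 1%g.
Proof.
move=> asc.
have ge_id i : (i <= r)%N -> (i <= image_at s i)%N.
  elim: i => // i IHi lt_ir; exact: leq_ltn_trans (IHi (ltnW lt_ir)) (asc i.+1 lt_ir).
have mono d : (d <= r.+1)%N -> excess s (r.+1 - d) <= 0.
  elim: d => [|d IHd] lt_d; first by rewrite subn0 excess_full.
  have := IHd (ltnW lt_d); have -> : (r.+1 - d = (r.+1 - d.+1).+1)%N by lia.
  by rewrite excessS; have := ge_id (r.+1 - d.+1)%N; lia.
apply: excess_inj => m le_m; rewrite excess1 //.
have := mono (r.+1 - m)%N; rewrite subKn //.
by have := excess_ge0 s le_m; lia.
Qed.

Lemma word_prod_cons k w :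
  word_prod r (k :: w) = (simple_refl r k * word_prod r w)%g.
Proof. by rewrite /word_prod big_cons. Qed.

Lemma card_inversions_word w : all is_letter w ->
  (#|inversions (word_prod r w)| <= size w)%N.
Proof.
elim: w => [_|k w IHw /= /andP[k_in w_in]].
  rewrite /word_prod big_nil leqn0 cards_eq0; apply/eqP/setP=> p.
  by rewrite !inE !perm1; lia.
rewrite word_prod_cons; move: (IHw w_in); set s := word_prod r w => le_w.
have [asc|desc|/image_at_ne//] := ltngtP (image_at s k.-1) (image_at s k).
  by rewrite card_inversions_asc.
by move: le_w; rewrite (card_inversions_desc k_in desc) => /ltnW/leqW.
Qed.

(** Sorting by descents uses one letter per inversion. *)
Lemma minimal_word s : exists2 w, is_word w s & size w = #|inversions s|.
Proof.
have [n] := ubnP #|inversions s|; elim: n s => // n IHn s lt_s.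
have [[k k_in desc]|no] := pselect
    (exists2 k, is_letter k & (image_at s k < image_at s k.-1)%N); last first.
  have s1 : s = 1%g.
    apply: no_descent_eq1 => k k_in.
    have [//|desc|/(image_at_ne k_in)//] := ltngtP (image_at s k.-1) (image_at s k).
    by case: no; exists k.
  exists [::]; first by split=> //; rewrite /word_prod big_nil s1.
  apply/esym/eqP; rewrite -leqn0.
  by have := @card_inversions_word [::] isT; rewrite /word_prod big_nil -s1.
have e := card_inversions_desc k_in desc.
have [|w [w_in w_s] sz] := IHn (simple_refl r k * s)%g; first by rewrite -ltnS -e.
exists (k :: w); last by rewrite /= sz e.
split; first by apply/andP.
by rewrite word_prod_cons w_s mulgA simple_reflK mul1g.
Qed.

(** A reduced word never removes an inversion: the shorter word that the sorting
    provides would contradict minimality. *)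
Lemma reduced_word_behead k w s : reduced_word (k :: w) s ->
  [/\ is_letter k, reduced_word w (word_prod r w)
    & (image_at (word_prod r w) k.-1 < image_at (word_prod r w) k)%N].
Proof.
case=> -[/= /andP[k_in w_in] <-] min_w.
have red : reduced_word w (word_prod r w).
  split=> // w' [w'_in w's]; have := min_w (k :: w'); rewrite /= ltnS; apply.
  by split; [apply/andP | rewrite !word_prod_cons w's].
split=> //; set s' := word_prod r w in min_w red *.
have [//|desc|/(image_at_ne k_in)//] := ltngtP (image_at s' k.-1) (image_at s' k).
have [w' w'P sz] := minimal_word (simple_refl r k * s')%g.
have lt_w := card_inversions_word w_in.
rewrite -/s' (card_inversions_desc k_in desc) in lt_w.
rewrite -word_prod_cons in w'P; have := min_w w' w'P.
by rewrite sz => /leq_trans/(_ (ltnW lt_w)); rewrite ltnn.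
Qed.

(** Along a reduced word each letter k creates an inversion between positions
    k - 1 and k, so by [excess_refl_mul] it strictly increases the excess at k
    and leaves the others alone: nothing is ever undone. *)
Lemma excess_reduced_word w s m : reduced_word w s -> (1 <= m <= r)%N ->
  (m \in w) = (excess s m != 0).
Proof.
move=> red m_in; have le_m : (m <= r.+1)%N by case/andP: m_in; lia.
elim: w s red => [|k w IHw] s red.
  case: red => -[_ <-] _; rewrite /word_prod big_nil.
  by rewrite excess1 // eqxx.
have [k_in redw asc] := reduced_word_behead red.
have e_s : s = (simple_refl r k * word_prod r w)%g.
  by case: red => -[_ <-] _; rewrite word_prod_cons.
rewrite inE (IHw _ redw) e_s excess_refl_mul //.
have := excess_ge0 (word_prod r w) le_m.
by case: eqVneq => _ /=; lia.
Qed.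

Lemma influenceP s m : influence s m <-> (1 <= m <= r)%N /\ excess s m != 0.
Proof.
split=> [[w red mw]|[m_in nz]].
  have m_in : (1 <= m <= r)%N by case: red => -[/allP/(_ m mw)].
  by rewrite -(excess_reduced_word red m_in).
have [w wP sz] := minimal_word s.
have red : reduced_word w s.
  by split=> // w' [w'_in w's]; rewrite sz -w's; apply: card_inversions_word.
by exists w => //; rewrite (excess_reduced_word red m_in).
Qed.

End Length.

(** * Products of independent elements *)

Section Products.
Variable r : nat.
Implicit Types (s t b : 'S_r.+1) (i k m : nat) (T : {set 'S_r.+1}).

Lemma influence_neq1 s : s != 1%g -> exists m, influence s m.
Proof.
move=> s_ne1; apply: contrapT => no; case/eqP: s_ne1.
apply: excess_inj => m le_m; rewrite excess1 //; apply/eqP.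
have [->|m_gt0] := posnP m; first by rewrite excess0.
have [->|ne_m] := eqVneq m r.+1; first by rewrite excess_full.
by apply: contraPT no => nz; case; exists m; apply/influenceP; split=> //; lia.
Qed.

Lemma independentP s t i k : independent s t -> influence s i ->
  influence t k -> i <> k /\ ~~ dynkin_adj i k.
Proof.
move=> ind s_i t_k; have [i_in _] := (influenceP s i).1 s_i.
have no : ~ ext_influence t i by move=> t_i; have: set0 i by rewrite -ind.
split=> [eik|]; first by apply: no; split=> //; constructor 1; rewrite eik.
apply/negP=> /orP[]/eqP e; apply: no; split=> //.
  by constructor 2; rewrite e.
by constructor 3; rewrite -e.
Qed.

(** At an index m where all the other factors stabilize the initial segment,
    the product is t up to multiplication by elements of that stabilizer. *)
Lemma excess_prod (ts : seq 'S_r.+1) t m : (m <= r.+1)%N -> uniq ts ->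
    t \in ts -> (forall t', t' \in ts -> t' != t -> excess t' m = 0) ->
  (excess (\prod_(b <- ts) b)%g m == 0) = (excess t m == 0).
Proof.
move=> le_m; elim: ts => // u ts IHts /= /andP[u_ts uniq_ts].
rewrite inE big_cons !excess_eq0 // => t_ts pres.
have [etu|ne_ut] := eqVneq u t.
  rewrite etu groupMr // big_seq; apply: group_prod => b b_ts.
  rewrite -excess_eq0 // pres ?inE ?b_ts ?orbT //.
  by apply: contraNneq u_ts => e; rewrite etu -e.
rewrite groupMl; last by rewrite -excess_eq0 // pres ?inE ?eqxx.
rewrite -!excess_eq0 // IHts //.
  by case/orP: t_ts => // /eqP etu; rewrite etu eqxx in ne_ut.
by move=> t' t'_ts; apply: pres; rewrite inE t'_ts orbT.
Qed.

Lemma influence_prod T m : pairwise_independent T ->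
  influence (\prod_(b in T) b)%g m <-> exists2 t, t \in T & influence t m.
Proof.
move=> indT; rewrite -big_filter influenceP; split=> [[m_in nz]|[t tT t_m]].
  apply: contrapT => no; case/negP: nz.
  have le_m : (m <= r.+1)%N by lia.
  rewrite excess_eq0 // big_seq; apply: group_prod => b.
  rewrite mem_filter => /andP[bT _]; rewrite -excess_eq0 //.
  by apply: contraPT no => nz; case; exists b => //; apply/influenceP.
have [m_in nz] := (influenceP t m).1 t_m; split=> //.
rewrite (excess_prod (t := t)) ?filter_uniq ?index_enum_uniq //; first by lia.
  by rewrite mem_filter tT mem_index_enum.
move=> t'; rewrite mem_filter => /andP[t'T _] ne_t't; apply/eqP.
apply/negPn/negP=> nz'.
have t'_m : influence t' m by apply/influenceP.
by have [] := independentP (indT _ _ t'T tT ne_t't) t'_m t_m.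
Qed.

(** The influence of the product is the union of the influences of the factors,
    and two distinct factors have no equal and no adjacent indices.  A path
    inside the union therefore never leaves the influence of one factor, so
    connectedness leaves room for a single factor. *)
Lemma connected_prod_mem T : pairwise_independent T -> 1%g \notin T ->
    connected_in_dynkin (influence (\prod_(b in T) b)%g) ->
    (\prod_(b in T) b)%g != 1%g ->
  (\prod_(b in T) b)%g \in T.
Proof.
move=> indT T1 conn ne1; have [m0] := influence_neq1 ne1.
have nontriv t : t \in T -> exists m, influence t m.
  by move=> tT; apply: influence_neq1; apply: contraNneq T1 => <-.
case/(influence_prod _ indT)=> t tT t_m0.
have sub m : influence (\prod_(b in T) b)%g m -> influence t m.
  move=> P_m; have P_m0 : influence (\prod_(b in T) b)%g m0.
    by apply/influence_prod => //; exists t.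
  have [p [p_path <- pP]] := conn m0 m P_m0 P_m.
  elim: p (m0) t_m0 p_path pP => //= x p IHp y t_y /andP[adj p_path] pP.
  apply: IHp => // [|z z_p]; last by apply: pP; rewrite inE z_p orbT.
  have /(influence_prod _ indT)[t' t'T t'_x] := pP x (mem_head x p).
  have [<-//|ne] := eqVneq t' t; rewrite eq_sym in ne.
  by have [_] := independentP (indT _ _ tT t'T ne) t_y t'_x; rewrite adj.
have -> : T = [set t].
  apply/setP=> t'; rewrite inE; apply/idP/eqP=> [t'T|->//].
  apply/eqP/negPn/negP=> ne; have [m t'_m] := nontriv t' t'T.
  have t_m : influence t m by apply: sub; apply/influence_prod => //; exists t'.
  by have [] := independentP (indT _ _ t'T tT ne) t'_m t_m.
by rewrite big_set1 set11.
Qed.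

(** Each b in S is a product of independent elements of S' and has connected
    influence, hence is one of these elements. *)
Lemma generates_sub (R : realFieldType) (lambda mu : 'cV[R]_r.+1)
    (S S' : {set 'S_r.+1}) :
    generates_alternation_set lambda mu S ->
    generates_alternation_set lambda mu S' ->
  S \subset S'.
Proof.
move=> [/fintype.subsetP SA S1 Sconn _] [_ S'1 _ S'gen].
apply/fintype.subsetP=> b bS.
have [T [/fintype.subsetP TS' indT eb]] := S'gen b (SA b bS).
apply: (TS' b); rewrite eb; apply: connected_prod_mem => //.
- by apply: contra S'1 => /TS'.
- by rewrite -eb; apply: Sconn.
- by rewrite -eb; apply: contraNneq S1 => <-.
Qed.

Lemma generates_is_BAS (R : realFieldType) (lambda mu : 'cV[R]_r.+1)
    (S : {set 'S_r.+1}) :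
  generates_alternation_set lambda mu S -> is_BAS lambda mu S.
Proof.
move=> genS; split=> // S' genS'.
by apply/eqP; rewrite finset.eqEsubset !(generates_sub genS, generates_sub genS').
Qed.

End Products.

(** * Sums of positive roots *)

Section AlternationSet.
Variables (R : realFieldType) (r : nat).
Implicit Types (s : 'S_r.+1) (v : 'cV[R]_r.+1) (i j k m : nat).

(** On vectors of sum 0 this is the coefficient of alpha_m in the basis of simple
    roots. *)
Definition prefix_sum m v : R := \sum_(i < r.+1 | (i < m)%N) v i 0.

Lemma prefix_sum_is_additive m : additive (prefix_sum m).
Proof.
by move=> u v; rewrite /prefix_sum -sumrB; apply: eq_bigr => i _; rewrite !mxE.
Qed.

HB.instance Definition _ m :=
  GRing.isZmodMorphism.Build _ _ (prefix_sum m) (prefix_sum_is_additive m).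

Lemma prefix_sum_basis m k : (1 <= k <= r.+1)%N ->
  prefix_sum m (basis_vec R r k) = (k <= m)%N%:R.
Proof.
case: k => // k le_k; rewrite /prefix_sum /basis_vec /coord /=.
have [lt_km|le_mk] := ltnP k m.
  rewrite (bigD1 (inord k)) ?inordK //= big1 ?addr0 ?mxE ?eqxx //.
  by move=> i /andP[_ ne]; rewrite mxE (negPf ne).
rewrite big1 // => i lt_im; rewrite mxE -val_eqE /= inordK //.
by have -> : (i == k :> nat) = false by lia.
Qed.

Lemma prefix_sum_root_sum m i j : (1 <= i <= j)%N -> (j <= r)%N ->
  prefix_sum m (root_sum R r i j) = (i <= m <= j)%N%:R.
Proof.
move=> ij_in le_jr; rewrite root_sumE // raddfB /= !prefix_sum_basis; try lia.
have : (j < m)%N ==> (i <= m)%N by lia.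
have -> : (i <= m <= j)%N = (i <= m)%N && ~~ (j < m)%N by lia.
by case: (i <= m)%N; case: (j < m)%N => // _; rewrite ?subrr ?subr0.
Qed.

Lemma pos_index_bounds (p : pos_index r) :
  (1 <= (val p).1 <= (val p).2)%N && ((val p).2 <= r)%N.
Proof. by rewrite (valP p) -ltnS ltn_ord. Qed.

Lemma prefix_sum_pos_root m (p : pos_index r) :
  prefix_sum m (pos_root R p) = ((val p).1 <= m <= (val p).2)%N%:R.
Proof. by apply: prefix_sum_root_sum; case/andP: (pos_index_bounds p). Qed.

Lemma eq_prefix_sum u v :
  (forall m, (m <= r.+1)%N -> prefix_sum m u = prefix_sum m v) -> u = v.
Proof.
move=> eq_uv; apply/colP=> i.
have entry (w : 'cV[R]_r.+1) : w i 0 = prefix_sum i.+1 w - prefix_sum i w.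
  apply/esym/eqP; rewrite subr_eq /prefix_sum (bigD1 i) //=; apply/eqP.
  by congr (_ + _); apply: eq_bigl => k; rewrite -val_eqE /=; lia.
by rewrite !entry !eq_uv // ltnW.
Qed.

(** Positive roots have nonnegative coefficients on the simple roots; conversely
    nonnegative integer coefficients are themselves a partition into simple
    roots. *)
Lemma kostant_gt0 v (c : nat -> int) : prefix_sum r.+1 v = 0 ->
    (forall m, (1 <= m <= r)%N -> prefix_sum m v = (c m)%:~R) ->
  (0 < kostant v)%N <-> forall m, (1 <= m <= r)%N -> 0 <= c m.
Proof.
move=> v0 cP; rewrite /kostant cardfs_gt0.
have -> : (fset_set (partitions v) != fset0) <-> exists f, partitions v f.
  split=> [/fset0Pn[f]|[f fP]].
    by rewrite in_fset_set ?inE; [exists f | apply: finite_partitions].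
  apply/fset0Pn; exists f; rewrite in_fset_set ?inE //.
  exact: finite_partitions.
split=> [[f fP] m m_in|c_ge0].
  rewrite -(ler0z R) -cP // -fP raddf_sum sumr_ge0 // => p _.
  by rewrite raddfMn mulrn_wge0 //= prefix_sum_pos_root ler0n.
exists [ffun p : pos_index r =>
  if (val p).1 == (val p).2 then `|c (val p).1|%N else 0%N].
apply: eq_prefix_sum => m le_m; rewrite raddf_sum /=.
have [m_in|m_out] := boolP (1 <= m <= r)%N; last first.
  rewrite big1 => [|p _].
    have [->|m_gt0] := posnP m; first by rewrite /prefix_sum big1.
    by have -> : m = r.+1 by lia.
  rewrite raddfMn /= prefix_sum_pos_root.
  have -> : ((val p).1 <= m <= (val p).2)%N = false.
    have := pos_index_bounds p.
    by move: (nat_of_ord (val p).1) (nat_of_ord (val p).2) => a b; lia.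
  by rewrite mul0rn.
have lt_m : (m < r.+1)%N by lia.
pose om : 'I_r.+1 := Ordinal lt_m.
have omP : (1 <= om <= om)%N by rewrite /=; lia.
pose p0 : pos_index r :=
  exist (fun p : 'I_r.+1 * 'I_r.+1 => (1 <= p.1 <= p.2)%N) (om, om) omP.
rewrite (bigD1 p0) //= big1 => [|p ne_p]; rewrite ffunE.
  rewrite eqxx addr0 raddfMn /= prefix_sum_pos_root /= leqnn cP //.
  by rewrite -[in RHS](gez0_abs (c_ge0 m m_in)).
case: eqP => [e|]; last by rewrite mulr0n raddf0.
rewrite raddfMn /= prefix_sum_pos_root -e.
case: (boolP (_ <= m <= _)%N) => [em|_]; last by rewrite mul0rn.
case/eqP: ne_p; apply: val_inj => /=.
have e1 : (val p).1 = om by apply/val_inj/eqP; rewrite eqn_leq.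
by rewrite [LHS]surjective_pairing -e e1.
Qed.

End AlternationSet.

(** * The alternation set in terms of the excess *)

Section HighestRoot.
Variables (R : realFieldType) (r : nat).
Implicit Types (s : 'S_r.+1) (v : 'cV[R]_r.+1) (i j k m : nat).

Lemma sum_gt_ord n i : (\sum_(b < n) (i < b)%N = n - i.+1)%N.
Proof.
by elim: n => [|n IHn]; rewrite ?big_ord0 // big_ord_recr /= IHn; case: ltnP; lia.
Qed.

Lemma sum_le_ord n i : (i <= n)%N -> (\sum_(a < n.+1) (1 <= a <= i) = i)%N.
Proof.
move=> le_in; transitivity (minn n i); last by apply/minn_idPr.
elim: n {le_in} => [|n IHn]; first by rewrite big_ord1 min0n.
by rewrite big_ord_recr /= IHn; case: (leqP n.+1 i) => ?; rewrite ?addn1 ?addn0; lia.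
Qed.

Lemma sum_pos_index (F : 'I_r.+1 * 'I_r.+1 -> nat) :
  (\sum_(p : pos_index r) F (val p) =
   \sum_(b < r.+1) \sum_(a < r.+1) (1 <= a <= b) * F (a, b))%N.
Proof.
rewrite exchange_big pair_big /=.
rewrite -(big_sub (fun p : 'I_r.+1 * 'I_r.+1 => (1 <= p.1 <= p.2)%N)).
rewrite big_mkcond; apply: eq_bigr => -[a b] _ /=; rewrite unfold_in /=.
by case: ifP => _; rewrite ?mul1n ?mul0n.
Qed.

Lemma pos_root_entry (p : pos_index r) (i : 'I_r.+1) :
  pos_root R p i 0 = ((val p).1 == i.+1 :> nat)%:R - ((val p).2 == i)%:R.
Proof.
have /andP[p_in p_le] := pos_index_bounds p.
rewrite /pos_root root_sumE // -[(val p).2 == i]val_eqE /=.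
move: (nat_of_ord (val p).1) (nat_of_ord (val p).2) p_in p_le => a b ab_in le_br.
rewrite !mxE /coord /= !andbT -!val_eqE /= !inordK ?(eq_sym b) //; last by lia.
by have -> : (i == a.-1 :> nat) = (a == i.+1 :> nat) by lia.
Qed.

(** The positive root e_a - e_(b+1) contributes 1 at position a - 1 and - 1 at
    position b, so the entry at i is half the difference between the number
    r - i of roots contributing 1 there and the number i contributing - 1. *)
Lemma rho_entry (i : 'I_r.+1) : rho R r i 0 = 2%:R^-1 * r%:R - i%:R.
Proof.
have le_ir : (i <= r)%N by rewrite -ltnS.
rewrite /rho mxE summxE.
under eq_bigr do rewrite pos_root_entry.
rewrite sumrB -!natr_sum.
rewrite (sum_pos_index (fun p => (p.1 == i.+1 :> nat) : nat)).
rewrite (sum_pos_index (fun p => (p.2 == i) : nat)) /=.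
have -> : (\sum_(b < r.+1) \sum_(a < r.+1) (1 <= a <= b) * (a == i.+1 :> nat) = r - i)%N.
  rewrite -[RHS](sum_gt_ord r.+1 i); apply: eq_bigr => b _.
  have [lt_ib|le_bi] := ltnP i b; last by rewrite big1 // => a _; lia.
  have lt_i : (i.+1 < r.+1)%N by apply: leq_ltn_trans lt_ib (ltn_ord b).
  rewrite (bigD1 (Ordinal lt_i)) //= eqxx lt_ib big1 // => a.
  by rewrite -val_eqE /= => /negPf->; rewrite muln0.
have -> : (\sum_(b < r.+1) \sum_(a < r.+1) (1 <= a <= b) * (b == i) = i)%N.
  rewrite (bigD1 i) //= [X in (_ + X)%N]big1 => [|b /negPf ne]; last first.
    by rewrite big1 // => a _; rewrite ne muln0.
  rewrite addn0 -[RHS](sum_le_ord le_ir); apply: eq_bigr => a _.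
  by rewrite eqxx muln1.
rewrite natrB // -addrA -opprD -mulr2n mulrBr -[i%:R *+ 2]mulr_natl mulrA.
by rewrite mulVf ?mul1r // pnatr_eq0.
Qed.

Lemma prefix_sum_weyl_act m s v :
  prefix_sum m (weyl_act s v) = \sum_(i < r.+1 | (i < m)%N) v (s i) 0.
Proof.
apply: eq_bigr => i _; rewrite /weyl_act -row_permE mxE.
by [].
Qed.

Lemma prefix_sum_weyl_rho m s : (m <= r.+1)%N ->
  prefix_sum m (weyl_act s (rho R r)) - prefix_sum m (rho R r)
    = - (excess s m)%:~R.
Proof.
move=> le_m; rewrite prefix_sum_weyl_act /prefix_sum -sumrB.
rewrite /excess big_mkord (big_ord_widen r.+1 (fun i => (image_at s i)%:Z - i%:Z)) //.
rewrite rmorph_sum -sumrN; apply: eq_bigr => i _ /=.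
rewrite rmorphB /= !rho_entry image_at_ord !opprB.
by rewrite addrC addrA subrK.
Qed.

Lemma prefix_sum_weyl_basis m s k : (1 <= k <= r.+1)%N ->
  prefix_sum m (weyl_act s (basis_vec R r k)) = ((s^-1)%g (coord r k) < m)%N%:R.
Proof.
move=> k_in; rewrite prefix_sum_weyl_act.
rewrite (reindex_inj (@perm_inj _ s^-1%g)) /= big_mkcond.
rewrite (bigD1 (coord r k)) //= big1 => [|i ne]; rewrite permKV mxE.
  by rewrite !eqxx addr0; case: ifP.
by rewrite (negPf ne) if_same.
Qed.

(** The coefficient of alpha_m in s (lambda + rho) - mu - rho, for lambda the
    highest root and mu = - alpha_(1, j); see [prefix_sum_root_coeff]. *)
Definition root_coeff j s m : int :=
  ((s^-1)%g ord0 < m)%N%:Z - ((s^-1)%g ord_max < m)%N%:Z + (m <= j)%N%:Z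
  - excess s m.

Lemma prefix_sum_root_coeff j s m : (1 <= j <= r)%N -> (1 <= m <= r.+1)%N ->
  prefix_sum m (weyl_act s (highest_root R r + rho R r)
                - - root_sum R r 1 j - rho R r) = (root_coeff j s m)%:~R.
Proof.
move=> j_in m_in; have le_m : (m <= r.+1)%N by lia.
have r_gt0 : (1 <= r)%N by lia.
have c0 : coord r 1 = ord0 by apply: val_inj; rewrite /= inordK.
have cr : coord r r.+1 = ord_max by apply: val_inj; rewrite /= inordK.
have -> : weyl_act s (highest_root R r + rho R r) - - root_sum R r 1 j - rho R r
    = weyl_act s (basis_vec R r 1) - weyl_act s (basis_vec R r r.+1)
      + root_sum R r 1 j + (weyl_act s (rho R r) - rho R r).
  rewrite /highest_root root_sumE ?r_gt0 // /weyl_act mulmxDr mulmxBr opprK.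
  by rewrite -!addrA; do 2!congr (_ + _); rewrite addrCA.
rewrite !(raddfB, raddfD) /= prefix_sum_weyl_rho // !prefix_sum_weyl_basis ?ltnS ?leqnn //.
have /andP[j_gt0 le_jr] := j_in; have /andP[m_gt0 _] := m_in.
by rewrite c0 cr prefix_sum_root_sum ?m_gt0.
Qed.

Lemma alternation_set_root_coeff j s : (1 <= j <= r)%N ->
  s \in alternation_set (highest_root R r) (- root_sum R r 1 j) <->
  forall m, (1 <= m <= r)%N -> 0 <= root_coeff j s m.
Proof.
move=> j_in; rewrite inE; apply: kostant_gt0 => [|m m_in].
  rewrite prefix_sum_root_coeff ?ltnS ?leqnn // /root_coeff.
  rewrite excess_full !ltn_ord.
  by have -> : (r.+1 <= j)%N = false by lia.
by apply: prefix_sum_root_coeff => //; lia.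
Qed.

End HighestRoot.

Section Admissible.
Variables (r j : nat).
Hypotheses (hj : (1 <= j)%N) (hjr : (j < r)%N).
Implicit Types (s t b : 'S_r.+1) (i k m n : nat).

(** The combinatorial form of membership in the alternation set.  The second
    condition says that the value 0 is not moved beyond position 1, and that if
    it moves at all then s exchanges 0 and 1. *)
Definition admissible s : Prop :=
  [/\ excess s r = 0, excess s 1 = 0 \/ excess s 2 = 0
    & forall m, (m <= r)%N -> excess s m <= 1 + (m <= j)%N%:Z].

(** At m = r the coefficient forbids s to move the value r, because r > j.  At
    m = 1 and m = 2 it limits where the value 0 can go; once 0 is among the
    first two values, for m >= 2 the coefficient is 1 + [m <= j] - excess. *)
Lemma admissibleP s : admissible s <->
  forall m, (1 <= m <= r)%N -> 0 <= root_coeff j s m.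
Proof.
have e1 : excess s 1 = (image_at s 0)%:Z by rewrite excessS excess0; lia.
have e2 : excess s 2 = (image_at s 0)%:Z + (image_at s 1)%:Z - 1.
  by rewrite excessS e1; lia.
have er : excess s r = r%:Z - (image_at s r)%:Z.
  by have := excess_full s; rewrite excessS; lia.
have ge1 : 0 <= excess s 1 by apply: excess_ge0.
have ge2 : 0 <= excess s 2 by apply: excess_ge0; lia.
have ger : 0 <= excess s r by apply: excess_ge0.
have inj01 : image_at s 0 <> image_at s 1 by move/image_at_inj; lia.
rewrite /root_coeff.
have := @initial_stabV r s _ ord0; have := @initial_stabV r s _ ord_max.
have := ltn_ord ((s^-1)%g ord0); have := ltn_ord ((s^-1)%g ord_max).
have := image_atV s ord0; have := image_atV s ord_max; rewrite /=.
move: (nat_of_ord ((s^-1)%g ord0)) (nat_of_ord ((s^-1)%g ord_max)) => a b.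
move=> sb sa lt_b lt_a b_stab a_stab.
split=> [[er0 e12 le_s] m m_in|c_ge0].
  have := b_stab r (leqnSn r) er0; rewrite ltnn => b_r.
  have := le_s m; have [e|e] := e12.
    by have := a_stab 1%N isT e; lia.
  have := a_stab 2%N _ e; have [m2|m1] := leqP 2%N m; first by lia.
  have -> : m = 1%N by lia.
  by lia.
split=> [||m le_m].
- have := c_ge0 r; have := b_stab r (leqnSn r); rewrite ltnn.
  have [lt_br|le_rb] := ltnP b r; first by lia.
  have e : b = r by lia.
  by rewrite e in sb; rewrite er sb subrr.
- have := c_ge0 1%N; have := c_ge0 2%N.
  have [a0|a_gt0] := posnP a; first by rewrite a0 in sa; left; lia.
  have [a1|ne1] := eqVneq a 1%N; first by rewrite a1 in sa; right; lia.
  have : image_at s 1 <> 0%N by move=> s1; case/eqP: ne1; apply: (@image_at_inj _ s); lia.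
  lia.
- by have [->|m_gt0] := posnP m; [rewrite excess0 | have := c_ge0 m; lia].
Qed.

End Admissible.

(** * The basic words and their excess *)

Section Blocks.
Variables (r j : nat).
Implicit Types (s t b : 'S_r.+1) (i k m n : nat).

(** The sequence with entries x, y, z at the indices k, k + 1, k + 2 and 0
    elsewhere; the indicator functions keep it within the reach of linear
    arithmetic. *)
Definition profile k x y z m : nat :=
  ((m == k) * x + (m == k.+1) * y + (m == k.+2) * z)%N.

Lemma profileE k x y z d : profile k x y z (k + d) = nth 0%N [:: x; y; z] d.
Proof. by case: d => [|[|[|d]]]; rewrite /profile /= ?nth_nil; lia. Qed.

Definition has_profile s k x y z : Prop :=
  forall m, (m <= r.+1)%N -> excess s m = (profile k x y z m)%:Z.

(** The excess sequences of the five families of words; the bounds on k are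
    those under which the sequence obeys [admissible]. *)
Inductive basic_profile k : nat -> nat -> nat -> Prop :=
| Profile1 of (1 <= k < r)%N : basic_profile k 1 0 0
| Profile12 of (2 <= k <= j - 1)%N : basic_profile k 1 2 0
| Profile21 of (2 <= k <= minn j (r - 2))%N : basic_profile k 2 1 0
| Profile22 of (2 <= k <= j - 1)%N : basic_profile k 2 2 0
| Profile212 of (2 <= k <= j - 2)%N : basic_profile k 2 1 2.

Definition basic_words : {set 'S_r.+1} :=
  ([set simple_refl r k | k : 'I_r & (1 <= k < r)%N] :|:
   [set simple_refl r k.+1 * simple_refl r k | k : 'I_r
      & (2 <= k <= j - 1)%N] :|:
   [set simple_refl r k * simple_refl r k.+1 | k : 'I_r
      & (2 <= k <= minn j (r - 2))%N] :|:
   [set simple_refl r k * simple_refl r k.+1 * simple_refl r k | k : 'I_r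
      & (2 <= k <= j - 1)%N] :|:
   [set simple_refl r k.+2 * simple_refl r k * simple_refl r k.+1 | k : 'I_r
      & (2 <= k <= j - 2)%N])%g.

Lemma excess_refl k m : (1 <= k <= r)%N -> (m <= r.+1)%N ->
  excess (simple_refl r k) m = (m == k)%:Z.
Proof.
move=> k_in le_m; rewrite -[simple_refl r k]mulg1 excess_refl_mul // excess1 //.
rewrite /image_at !perm1 !inordK; lia.
Qed.

Lemma profile1 k : (1 <= k <= r)%N -> has_profile (simple_refl r k) k 1 0 0.
Proof. by move=> k_in m le_m; rewrite excess_refl // /profile; lia. Qed.

Lemma profile12 k : (1 <= k < r)%N ->
  has_profile (simple_refl r k.+1 * simple_refl r k)%g k 1 2 0.
Proof.
move=> k_in m le_m; rewrite excess_refl_mul ?excess_refl ?image_at_refl //; try lia.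
rewrite /profile /=; lia.
Qed.

Lemma profile21 k : (1 <= k < r)%N ->
  has_profile (simple_refl r k * simple_refl r k.+1)%g k 2 1 0.
Proof.
move=> k_in m le_m; rewrite excess_refl_mul ?excess_refl ?image_at_refl //; try lia.
rewrite /profile /=; lia.
Qed.

Lemma profile22 k : (1 <= k < r)%N ->
  has_profile (simple_refl r k * simple_refl r k.+1 * simple_refl r k)%g k 2 2 0.
Proof.
move=> k_in m le_m; rewrite -mulgA excess_refl_mul //; last by lia.
rewrite !image_at_excess !profile12 //; try lia.
by rewrite /profile; case: eqVneq => [->|_]; lia.
Qed.

Lemma profile212 k : (1 <= k)%N -> (k.+1 < r)%N ->
  has_profile (simple_refl r k.+2 * simple_refl r k * simple_refl r k.+1)%g
    k 2 1 2.
Proof.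
move=> k_gt0 lt_kr m le_m; rewrite -mulgA excess_refl_mul //.
rewrite !image_at_excess !profile21 //; try lia.
by rewrite /profile; case: (eqVneq m k.+2) => [->|_]; lia.
Qed.

Lemma interval_connected (I : set nat) lo hi :
  (forall i, I i <-> (lo <= i <= hi)%N) -> connected_in_dynkin I.
Proof.
move=> IP i k /IP i_in /IP k_in.
have [d] := ubnP (i - k + (k - i))%N; elim: d => // d IHd in i i_in *.
have [lt_ik|lt_ki|->] := ltngtP i k => le_d; last by exists [::].
- have [||p [p_path p_last pI]] := IHd i.+1; try lia.
  exists (i.+1 :: p); rewrite /= p_path p_last /dynkin_adj eqxx; split=> // x.
  by rewrite inE => /orP[/eqP->|/pI//]; apply/IP; lia.
- have [||p [p_path p_last pI]] := IHd i.-1; try lia.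
  exists (i.-1 :: p); rewrite /= p_path p_last /dynkin_adj andbT; split=> //.
    by apply/orP; right; apply/eqP; lia.
  by move=> x; rewrite inE => /orP[/eqP->|/pI//]; apply/IP; lia.
Qed.

Hypotheses (hj : (1 <= j)%N) (hjr : (j < r)%N).

(** A permutation is determined by its excess sequence, so membership can be read
    off from that sequence. *)
Lemma basic_wordsP s : s \in basic_words <->
  exists k x y z, basic_profile k x y z /\ has_profile s k x y z.
Proof.
split=> [|[k [x [y [z [kxyz s_prof]]]]]].
  rewrite !inE => /orP[/orP[/orP[/orP[]|]|]|] /imsetP[ok]; rewrite inE;
    move: (nat_of_ord ok) => k {ok} k_in ->; exists k.
  - exists 1%N, 0%N, 0%N; split; [exact: Profile1 | apply: profile1; lia].
  - exists 1%N, 2%N, 0%N; split; [exact: Profile12 | apply: profile12; lia].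
  - exists 2%N, 1%N, 0%N; split; [exact: Profile21 | apply: profile21; lia].
  - exists 2%N, 2%N, 0%N; split; [exact: Profile22 | apply: profile22; lia].
  - exists 2%N, 1%N, 2%N; split; [exact: Profile212 | apply: profile212; lia].
have eq_s t : has_profile t k x y z -> s = t.
  by move=> t_prof; apply: excess_inj => m le_m; rewrite s_prof ?t_prof.
have lt_kr : (k < r)%N by case: kxyz; lia.
pose ok : 'I_r := Ordinal lt_kr.
rewrite !inE -!orbA; case: kxyz eq_s => k_in eq_s; apply/or4P.
- constructor 1; apply/imsetP; exists ok; rewrite ?inE //.
  by apply: eq_s; apply: (profile1 (k := k)); lia.
- constructor 2; apply/imsetP; exists ok; rewrite ?inE //.
  by apply: eq_s; apply: (profile12 (k := k)); lia.
- constructor 3; apply/imsetP; exists ok; rewrite ?inE //.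
  by apply: eq_s; apply: (profile21 (k := k)); lia.
- constructor 4; apply/orP; left; apply/imsetP; exists ok; rewrite ?inE //.
  by apply: eq_s; apply: (profile22 (k := k)); lia.
- constructor 4; apply/orP; right; apply/imsetP; exists ok; rewrite ?inE //.
  by apply: eq_s; apply: (profile212 (k := k)); lia.
Qed.

Lemma basic_words_admissible b : b \in basic_words -> admissible j b.
Proof.
case/basic_wordsP=> k [x [y [z [kxyz b_prof]]]]; split=> [||m le_m].
- by rewrite b_prof // /profile; case: kxyz; lia.
- by rewrite !b_prof ?ltnS // ?(leq_trans hj (ltnW hjr)) // /profile; case: kxyz; lia.
- by rewrite b_prof ?leqW // /profile; case: kxyz; lia.
Qed.

Lemma basic_words_neq1 : 1%g \notin basic_words.
Proof.
apply/negP=> /basic_wordsP[k [x [y [z [kxyz prof]]]]].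
have := prof k; rewrite excess1 /profile; case: kxyz; lia.
Qed.

Lemma basic_words_connected b : b \in basic_words ->
  connected_in_dynkin (influence b).
Proof.
case/basic_wordsP=> k [x [y [z [kxyz b_prof]]]].
apply: (@interval_connected _ k (k + (0 < y) + (0 < z)))%N => i.
rewrite influenceP; split=> [[i_in]|i_in].
  by rewrite b_prof ?eqz_nat /profile; case: kxyz i_in; lia.
have i_in' : (1 <= i <= r)%N by case: kxyz i_in; lia.
split=> //; rewrite b_prof ?eqz_nat /profile; case: kxyz i_in; lia.
Qed.

End Blocks.

(** * Factorization into basic words *)

Section CommutingProduct.
Variable gT : finGroupType.

Lemma big_commute_rem (xs : seq gT) (P : pred gT) b : uniq xs -> b \in xs ->
    P b -> (forall t, P t -> commute b t) ->
  (\prod_(t <- xs | P t) t = b * \prod_(t <- xs | P t && (t != b)) t)%g.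
Proof.
move=> + + Pb comm_b; elim: xs => //= x xs IHxs /andP[x_xs uniq_xs].
rewrite inE !big_cons; have [ebx _|_ /= b_xs] := eqVneq b x.
  rewrite -ebx in x_xs *; rewrite Pb /=; congr (_ * _)%g.
  rewrite big_seq_cond [RHS]big_seq_cond.
  apply: eq_bigl => t; case: eqVneq => [->|]; last by rewrite !andbT.
  by rewrite (negPf x_xs) !andbF.
rewrite IHxs // andbT; case: ifP => // Px.
by rewrite !mulgA (comm_b x Px).
Qed.

Lemma prod_setU1_commute (T : {set gT}) b : b \notin T ->
    (forall t, t \in T -> commute b t) ->
  (\prod_(t in b |: T) t = b * \prod_(t in T) t)%g.
Proof.
move=> bT comm_b; rewrite (big_commute_rem (b := b)) ?index_enum_uniq //.
- congr (_ * _)%g; apply: eq_bigl => t; rewrite !inE.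
  by case: eqVneq => [->|]; rewrite ?(negPf bT) ?andbF ?andbT.
- by rewrite mem_index_enum.
- by rewrite setU11.
- by move=> t; rewrite !inE => /predU1P[->|/comm_b].
Qed.

End CommutingProduct.

Section Factorization.
Variables (r j : nat).
Implicit Types (s t b : 'S_r.+1) (i k m n : nat).

Local Notation basic_words := (basic_words r j).
Local Notation basic_profile := (basic_profile r j).

(** Below n the factors b^-1 and s cancel, and from n on b^-1 is the identity, so
    that b is split off from s on the left. *)
Lemma peel_left s b n : (n <= r.+1)%N ->
    (forall m, (m <= n)%N -> excess s m = excess b m) ->
    (forall m, (n <= m <= r.+1)%N -> excess b m = 0) ->
  forall m, (m <= r.+1)%N ->
    excess (b^-1 * s)%g m = if (m <= n)%N then 0 else excess s m.
Proof.
move=> le_n eq_sb b0.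
have b_fix i : (n <= i <= r)%N -> image_at b i = i.
  by move=> i_in; have := image_at_excess b i; rewrite !b0; lia.
have eq_im i : (i < n)%N -> image_at s i = image_at b i.
  by move=> lt_in; have := image_at_excess b i; have := image_at_excess s i; rewrite !eq_sb; lia.
have sn0 : excess s n = 0 by rewrite eq_sb // b0 // leqnn.
apply: (@excess_unique _ _ (fun m => if (m <= n)%N then 0 else excess s m)) => //.
move=> i le_ir; rewrite image_atM; set k := image_at b^-1 i.
have bk : image_at b k = i.
  by rewrite /k -image_atM mulVg /image_at perm1 inordK.
have le_kr : (k <= r)%N by apply: image_at_le.
have [lt_in|le_ni] := ltnP i n.
  have lt_kn : (k < n)%N.
    by rewrite ltnNge; apply/negP=> le_nk; have := b_fix k; lia.
  by rewrite eq_im // bk (ltnW lt_in) subrr addr0.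
have ->: k = i by apply: (@image_at_inj _ b) => //; rewrite bk b_fix ?le_ni.
rewrite excessS; have [le_in|lt_ni] := leqP i n; last by [].
have ->: i = n by lia.
by rewrite sn0.
Qed.

Lemma commute_split b t n : (forall m, (n <= m <= r.+1)%N -> excess b m = 0) ->
  (forall m, (m <= n)%N -> excess t m = 0) -> commute b t.
Proof.
move=> b0 t0; apply: (@perm_onC _ [set i : 'I_r.+1 | (i < n)%N]
                                  [set i : 'I_r.+1 | (n <= i)%N]).
- apply/fintype.subsetP=> i; rewrite !inE; apply: contraR; rewrite -leqNgt => le_ni.
  by rewrite fixed_of_excess0 // b0 // ?(leqW le_ni) ?le_ni ?ltn_ord ?(ltnW (ltn_ord i)).
- apply/fintype.subsetP=> i; rewrite !inE; apply: contraR; rewrite -ltnNge => lt_in.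
  by rewrite fixed_of_excess0 // t0 // ltnW.
by rewrite -setI_eq0; apply/eqP/setP=> i; rewrite !inE; case: ltnP.
Qed.

Lemma independent_split b t n : (forall m, (n <= m <= r.+1)%N -> excess b m = 0) ->
    (forall m, (m <= n)%N -> excess t m = 0) ->
  independent b t /\ independent t b.
Proof.
move=> b0 t0.
have b_lt m : influence b m -> (m < n)%N.
  by case/influenceP=> m_in; apply: contraNT; rewrite -leqNgt => le_nm; rewrite b0; lia.
have t_gt m : influence t m -> (n < m)%N.
  by case/influenceP=> m_in; apply: contraNT; rewrite -leqNgt => le_nm; rewrite t0.
split; apply/seteqP; split=> // m [].
- by move=> /b_lt b_m [_ [/t_gt|/t_gt|/t_gt]]; lia.
- by move=> /t_gt t_m [_ [/b_lt|/b_lt|/b_lt]]; lia.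
Qed.

Hypotheses (hj : (1 <= j)%N) (hjr : (j < r)%N).

(** The excess sequence is followed from its first nonzero entry on until it
    returns to 0.  Its entries lie in {0, 1, 2}, and s i = i + excess (i + 1) - excess i must
    be a value that has not been used yet; this leaves the five sequences
    1, 12, 21, 22 and 212, each followed by a 0. *)
Lemma leading_profile s k : admissible j s -> (1 <= k <= r.+1)%N ->
    (forall m, (m < k)%N -> excess s m = 0) -> excess s k != 0 ->
  exists x y z n, [/\ basic_profile k x y z, (k < n <= r)%N,
    forall m, (n <= m)%N -> profile k x y z m = 0%N
    & forall m, (m <= n)%N -> excess s m = (profile k x y z m)%:Z].
Proof.
move=> [er e12 le_s] k_in lt_k nz_k.
have efull := excess_full s.
have ge0 m : (m <= r.+1)%N -> 0 <= excess s m by apply: excess_ge0.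
have lt_kr : (k < r)%N.
  have [|le_rk] := ltnP k r; first by [].
  have [e|ne] := eqVneq k r; first by rewrite e er in nz_k.
  by rewrite (_ : k = r.+1) ?efull in nz_k; lia.
have inj a c : (a <= r)%N -> (c <= r)%N -> a <> c -> image_at s a <> image_at s c.
  by move=> le_a le_c ne /image_at_inj => /(_ le_a le_c).
have gek := ge0 k; have lek := le_s k (ltnW lt_kr).
have le1 : (k.+1 <= r)%N by [].
have ge1 : 0 <= excess s k.+1 by apply: ge0; lia.
have ge2 : 0 <= excess s k.+2 by apply: ge0; lia.
have sk1 : excess s k.-1 = 0 by apply: lt_k; lia.
have v0 := image_at_excess s k.-1; have v0k : (k.-1.+1 = k)%N by lia.
rewrite v0k sk1 in v0.
have v1 := image_at_excess s k; have v2 := image_at_excess s k.+1.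
have v3 := image_at_excess s k.+2.
have i01 : image_at s k.-1 <> image_at s k by apply: inj; lia.
have i02 : image_at s k.-1 <> image_at s k.+1 by apply: inj; lia.
have i12 : image_at s k <> image_at s k.+1 by apply: inj; lia.
have lt_r m : (m <= r)%N -> excess s m != 0 -> (m < r)%N.
  by rewrite leq_eqVlt => /predU1P[->|//]; rewrite er.
have build x y z l : basic_profile k x y z -> (0 < l)%N -> (k + l <= r)%N ->
    (forall d, (l <= d)%N -> nth 0%N [:: x; y; z] d = 0%N) ->
    (forall d, (d <= l)%N -> excess s (k + d) = (nth 0%N [:: x; y; z] d)%:Z) ->
  exists x y z n, [/\ basic_profile k x y z, (k < n <= r)%N,
    forall m, (n <= m)%N -> profile k x y z m = 0%N
    & forall m, (m <= n)%N -> excess s m = (profile k x y z m)%:Z].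
  move=> kxyz l_gt0 le_r z0 s_p; exists x, y, z, (k + l)%N.
  split=> // [|m le_m|m le_m].
  - by rewrite le_r -[X in (X < _)%N]addn0 ltn_add2l l_gt0.
  - have -> : m = (k + (m - k))%N by rewrite subnKC // (leq_trans _ le_m) ?leq_addr.
    by rewrite profileE z0 // leq_subRL // (leq_trans _ le_m) ?leq_addr.
  have [lt_mk|le_km] := ltnP m k.
    by rewrite lt_k //; clear -lt_mk; rewrite /profile; lia.
  have -> : m = (k + (m - k))%N by rewrite subnKC.
  by rewrite s_p ?profileE // leq_subLR.
have [e0|e0] : excess s k = 1 \/ excess s k = 2 by lia.
- have [e1|e1] : excess s k.+1 = 0 \/ excess s k.+1 = 2.
    have := le_s k.+1 le1; lia.
    apply: (build 1 0 0 1)%N; rewrite ?addn1 //.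
    + by apply: Profile1; lia.
    + by case=> [|[|[|[|d]]]].
    + by case=> [|[|d]] //; rewrite ?addn0 ?addn1.
  have lt1 : (k.+1 < r)%N by apply: lt_r; rewrite // e1.
  have e2 : excess s k.+2 = 0 by have := le_s k.+2 lt1; lia.
  have le1j := le_s k.+1 le1.
  have k2 : (2 <= k)%N.
    have [k1|//] := leqP k 1; have k_1 : k = 1%N by lia.
    by rewrite k_1 in e0 e1; case: e12 => e; lia.
  apply: (build 1 2 0 2)%N; rewrite ?addn2 //.
  + by apply: Profile12; lia.
  + by case=> [|[|[|[|d]]]].
  + by case=> [|[|[|d]]] //; rewrite ?addn0 ?addn1 ?addn2.
(* If k = 1, then the excess at 2 vanishes, and s 1 would be - 1; hence k >= 2,
   and the value k - 2 is already taken. *)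
have k2 : (2 <= k)%N.
  have [k1|//] := leqP k 1; have k_1 : k = 1%N by lia.
  by rewrite k_1 in e0 v1; case: e12 => e; lia.
have sk2 : excess s k.-2 = 0 by apply: lt_k; lia.
have vm := image_at_excess s k.-2; have vmk : (k.-2.+1 = k.-1)%N by lia.
rewrite vmk sk1 sk2 in vm.
have im1 : image_at s k.-2 <> image_at s k by apply: inj; lia.
have le1j := le_s k.+1 le1.
have [e1|e1] : excess s k.+1 = 1 \/ excess s k.+1 = 2 by lia.
all: have lt1 : (k.+1 < r)%N by apply: lt_r; rewrite // e1.
all: have le2j := le_s k.+2 lt1.
- have [e2|e2] : excess s k.+2 = 0 \/ excess s k.+2 = 2 by lia.
    apply: (build 2 1 0 2)%N; rewrite ?addn2 //.
    + by apply: Profile21; lia.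
    + by case=> [|[|[|[|d]]]].
    + by case=> [|[|[|d]]] //; rewrite ?addn0 ?addn1 ?addn2.
  have lt2 : (k.+2 < r)%N by apply: lt_r; rewrite // e2.
  have i03 : image_at s k.-1 <> image_at s k.+2 by apply: inj; lia.
  have i23 : image_at s k.+1 <> image_at s k.+2 by apply: inj; lia.
  have ge3 : 0 <= excess s k.+3 by apply: ge0; lia.
  have e3 : excess s k.+3 = 0 by have := le_s k.+3 lt2; lia.
  apply: (build 2 1 2 3)%N; rewrite ?addn3 //.
  + by apply: Profile212; lia.
  + by case=> [|[|[|[|d]]]].
  + by case=> [|[|[|[|d]]]] //; rewrite ?addn0 ?addn1 ?addn2 ?addn3.
have e2 : excess s k.+2 = 0 by lia.
apply: (build 2 2 0 2)%N; rewrite ?addn2 //.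
+ by apply: Profile22; lia.
+ by case=> [|[|[|[|d]]]].
+ by case=> [|[|[|d]]] //; rewrite ?addn0 ?addn1 ?addn2.
Qed.

Lemma basic_profile_word k x y z : basic_profile k x y z ->
  exists2 b, b \in basic_words & has_profile b k x y z.
Proof.
move=> kxyz; suff [b b_prof] : exists b, has_profile b k x y z.
  by exists b => //; apply/basic_wordsP => //; exists k, x, y, z.
case: kxyz => k_in.
- by exists (simple_refl r k); apply: (profile1 (k := k)); lia.
- by exists (simple_refl r k.+1 * simple_refl r k)%g; apply: (profile12 (k := k)); lia.
- by exists (simple_refl r k * simple_refl r k.+1)%g; apply: (profile21 (k := k)); lia.
- exists (simple_refl r k * simple_refl r k.+1 * simple_refl r k)%g.
  by apply: (profile22 (k := k)); lia.
- exists (simple_refl r k.+2 * simple_refl r k * simple_refl r k.+1)%g.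
  by apply: (profile212 (k := k)); lia.
Qed.

(** The part of s up to the first return of its excess to 0 is a basic word by
    [leading_profile]; what remains has excess 0 through that return, so it is
    independent of the basic word, and is again admissible. *)
Lemma admissible_factorization s n : admissible j s ->
    (forall m, (m <= n)%N -> excess s m = 0) ->
  exists T : {set 'S_r.+1},
    [/\ T \subset basic_words, pairwise_independent T, s = (\prod_(b in T) b)%g
      & forall t, t \in T -> forall m, (m <= n)%N -> excess t m = 0].
Proof.
have [d] := ubnP (r.+1 - n)%N; elim: d => // d IHd in s n *.
move=> le_d adm_s s0; have [le_rn|lt_nr] := leqP r.+1 n.
  exists finset.set0; split=> [|s' t'|| t']; rewrite ?finset.sub0set ?inE //.
  rewrite finset.big_set0; apply: excess_inj => m le_m.
  by rewrite excess1 // s0 // (leq_trans le_m).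
have [e|ne] := eqVneq (excess s n.+1) 0.
  have [|||T [TS indT eT T0]] := IHd s n.+1 => //; first by lia.
    by move=> m; rewrite leq_eqVlt => /predU1P[->//|/s0].
  by exists T; split=> // t tT m le_m; apply: T0 => //; apply: leqW.
have [x [y [z [N [kxyz N_in p0 s_p]]]]] :=
  leading_profile (k := n.+1) adm_s lt_nr s0 ne.
have [b bS b_p] := basic_profile_word kxyz.
have b0 m : (N <= m <= r.+1)%N -> excess b m = 0.
  by case/andP=> le_Nm le_m; rewrite b_p // p0.
have sb m : (m <= N)%N -> excess s m = excess b m.
  by move=> le_m; rewrite s_p // b_p //; lia.
have le_N : (N <= r.+1)%N by lia.
have peel := peel_left le_N sb b0; set s' := (b^-1 * s)%g in peel.
have s'0 m : (m <= N)%N -> excess s' m = 0.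
  by move=> le_m; rewrite peel ?le_m //; lia.
have adm_s' : admissible j s'.
  case: adm_s => er e12 le_s; split=> [||m le_m].
  - by rewrite peel // er if_same.
  - by case: e12 => e; [left | right]; rewrite peel ?e ?if_same //; lia.
  - by rewrite peel ?leqW //; case: ifP => // _; apply: le_s.
have [|T [TS indT eT T0]] := IHd s' N _ adm_s' s'0; first by lia.
have indb t : t \in T -> independent b t /\ independent t b.
  by move=> tT; apply: independent_split b0 (T0 t tT).
have b_n : excess b n.+1 != 0 by rewrite -sb //; lia.
have bT : b \notin T by apply: contra b_n => /T0->//; lia.
exists (b |: T); split.
- by rewrite finset.subUset finset.sub1set bS.
- move=> t u; rewrite !inE => /predU1P[->|tT] /predU1P[->|uT].
  + by rewrite eqxx.
  + by case: (indb u uT).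
  + by case: (indb t tT).
  + exact: indT.
- rewrite prod_setU1_commute // -?eT ?mulKVg // => t tT.
  exact: commute_split b0 (T0 t tT).
- move=> t; rewrite !inE => /predU1P[->|tT] m le_m.
    by rewrite -sb ?s0 //; lia.
  by apply: T0 => //; lia.
Qed.

End Factorization.

Local Close Scope ring_scope.

Theorem corollary4p9 (R : realFieldType) (r j : nat)
    (hj : (1 <= j)%N) (hjr : (j < r)%N) :
  is_BAS (highest_root R r) (- root_sum R r 1 j)%R
    ([set simple_refl r k | k : 'I_r & (1 <= k < r)%N] :|:
     [set simple_refl r k.+1 * simple_refl r k | k : 'I_r
        & (2 <= k <= j - 1)%N] :|:
     [set simple_refl r k * simple_refl r k.+1 | k : 'I_r
        & (2 <= k <= minn j (r - 2))%N] :|: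
     [set simple_refl r k * simple_refl r k.+1 * simple_refl r k | k : 'I_r
        & (2 <= k <= j - 1)%N] :|:
     [set simple_refl r k.+2 * simple_refl r k * simple_refl r k.+1 | k : 'I_r
        & (2 <= k <= j - 2)%N])%g.
Proof.
have j_in : (1 <= j <= r)%N by rewrite hj ltnW.
have altP s : s \in alternation_set (highest_root R r) (- root_sum R r 1 j)%R
    <-> admissible j s.
  rewrite (alternation_set_root_coeff R s j_in).
  by split=> [/(admissibleP hj hjr)|/(admissibleP hj hjr)].
apply: (@generates_is_BAS r R _ _ (basic_words r j)); split.
- by apply/fintype.subsetP=> b bS; apply/altP/basic_words_admissible.
- exact: basic_words_neq1.
- by move=> b; apply: basic_words_connected.
move=> s /altP adm_s.
have s0 m : (m <= 0)%N -> excess s m = 0%R by rewrite leqn0 => /eqP->; rewrite excess0.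
have [T [TS indT eT _]] := admissible_factorization hj hjr adm_s s0.
by exists T.
Qed.
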